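(* Let $X$ and $Y$ be two Banach spaces. Assume that $f:X\to Y$ and $g:Y\to X$ are continuous, and that there exist constants $C,D,M>0$ such that $$\forall y,y'\in Y\ \ \|g(y)-g(y')\|\le D+M\|y-y'\|$$ and $$\forall x\in X\ \ \|(g\circ f)(x)-x\|\le C\quad\text{and}\quad\forall y\in Y\ \ \|(f\circ g)(y)-y\|\le C.$$ Let $0<\lambda<1$. Then for any $\alpha\ge \alpha_0=2(C+D)(1-\lambda)^{-1}$ and any closed finite codimensional subspace $X_0$ of $X$, there is a compact subset $K$ of $Y$ such that $$\frac{\lambda\alpha}{M}B_Y\subset K+CB_Y+f(2\alpha B_{X_0}).$$
   Context: $B_Z$ denotes the closed unit ball of a Banach space $Z$. *)

(* Defs.v *)
From HB Require Import structures.
From mathcomp Require Import all_boot all_order all_algebra.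
From mathcomp Require Import all_classical all_reals all_analysis.

Set Implicit Arguments.
Unset Strict Implicit.
Unset Printing Implicit Defensive.

Import Order.TTheory GRing.Theory Num.Theory.
Import numFieldNormedType.Exports.

Local Open Scope classical_set_scope.
Local Open Scope ring_scope.

Definition unit_ball (R : realType) (Z : normedModType R) : set Z :=
  closed_ball_ (fun z : Z => `|z|) 0 1.
Arguments unit_ball {R} Z.

Definition scale_set (R : realType) (Z : lmodType R) (c : R) (A : set Z) :
  set Z := [set c *: z | z in A].

Definition add_set (Z : zmodType) (A B : set Z) : set Z :=
  [set a + b | a in A & b in B].

Definition linear_subspace (R : realType) (Z : lmodType R) (Z0 : set Z) :
  Prop := submod_closed (mem Z0).

(* The quotient Z / Z0 is spanned by the classes of e_0, ..., e_(n-1). The e_i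
   need not be independent modulo Z0, and n = 0 gives Z0 = Z. *)
Definition finite_codimensional (R : realType) (Z : lmodType R) (Z0 : set Z) :
  Prop :=
  exists (n : nat) (e : 'I_n -> Z), forall z : Z,
    exists a : 'I_n -> R, Z0 (z - \sum_(i < n) a i *: e i).

(* Main.v *)
Require Import Defs.
From HB Require Import structures.
From mathcomp Require Import all_boot all_order all_algebra.
From mathcomp Require Import all_classical all_reals all_analysis.
From mathcomp Require Import ring lra.
Import Order.TTheory GRing.Theory Num.Theory.
Import numFieldNormedType.Exports.

Set Implicit Arguments.
Unset Strict Implicit.
Unset Printing Implicit Defensive.

Local Open Scope ring_scope.

(** This is a coarse form of the Gorelik principle.  Put
    r = C + D + lambda alpha.  The hypothesis on alpha says exactly that
    C + D <= alpha (1 - lambda) / 2, hence r < alpha.  For y in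
    (lambda alpha / M) B_Y the continuous map phi(x) = g(y + f(x)) moves every
    point of X by at most r: g(f(x)) is within C of x, and replacing f(x) by
    y + f(x) costs at most D + M |y| <= D + lambda alpha.

    The topological core is [gorelik_principle]: there is one compact subset A
    of alpha B_X, depending only on X0, r and alpha, such that every continuous
    phi moving points by at most r sends some a in A into X0.  With x = phi(a)
    one gets |x| <= |a| + r <= 2 alpha, and f(x) = f(g(y + f(a))) is within C of
    y + f(a).  So y = - f(a) + (y + f(a) - f(x)) + f(x) is the wanted
    decomposition, and K = - f(A) works for all y simultaneously.

    To obtain A, describe X modulo X0 by a bounded linear map P from X to R^n
    and a bounded linear L from R^n to X, with P = 0 on X0 and x - L (P x) in X0
    ([closed_finite_codim_quotient]).  Because r < alpha there is a continuous,
    nonlinear S from R^n to alpha B_X with P (S (P x)) = P x whenever |x| <= r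
    ([continuous_lift]).  The map v |-> P (S v - phi (S v)) is continuous and
    bounded, so it has a fixed point v by Brouwer's theorem.  Then v is P of the
    vector S v - phi (S v), whose norm is at most r; hence P (S v) = v, so
    P (phi (S v)) = 0 and phi (S v) lies in X0.  A is the image under S of a cube
    that contains all possible fixed points.

    Brouwer's theorem ([brouwer_bounded]) is deduced from a combinatorial lemma
    on labelled grids ([kuhn_cube]), which is proved by a mod 2 computation with
    cubical cochains: the cup product of the coboundaries of n labellings is
    itself a coboundary, and summing it over a box leaves a boundary term that
    is computed by induction on the dimension. *)

(** * A labelling lemma on cubical grids *)

Section CubicalCup.
Context {n : nat}.
Implicit Types (x y : 'I_n -> nat) (i j : 'I_n) (S : {set 'I_n}).
Implicit Types (f : ('I_n -> nat) -> bool) (fs : seq (('I_n -> nat) -> bool)).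

Definition upd x i c : 'I_n -> nat := fun k => if k == i then c else x k.
Definition step x i := upd x i (x i).+1.

Lemma upd_eq x i c : upd x i c i = c.
Proof. by rewrite /upd eqxx. Qed.

Lemma upd_neq x i c k : k != i -> upd x i c k = x k.
Proof. by rewrite /upd => /negbTE ->. Qed.

Lemma updC x i j c d : i != j -> upd (upd x i c) j d = upd (upd x j d) i c.
Proof.
move=> ij; apply/funext => k; rewrite /upd.
by case: eqVneq => // ->; rewrite eq_sym (negbTE ij).
Qed.

Lemma upd_upd x i c d : upd (upd x i c) i d = upd x i d.
Proof. by apply/funext => k; rewrite /upd; case: eqVneq. Qed.

Lemma stepC x i j : i != j -> step (step x i) j = step (step x j) i.
Proof.
move=> ij; rewrite /step (upd_neq _ _ ij) upd_neq; last by rewrite eq_sym.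
exact: updC.
Qed.

(** The value, on the cube with lowest vertex [x] and edge directions [S], of the
    cubical cup product of the coboundaries of the 0-cochains in [fs].
    Coefficients are in the field with two elements, realised by [bool]. *)
Fixpoint cup fs S x : bool :=
  if fs is f :: fs' then
    \sum_(i in S) (f (step x i) + f x) * cup fs' (S :\ i) (step x i)
  else 1.

Lemma addbool (b : bool) : b + b = 0.
Proof. by case: b. Qed.

Lemma sum_bool_exists (J : finType) (A : pred J) (F : J -> bool) :
  \sum_(j | A j) F j -> exists2 j, A j & F j.
Proof.
move=> sT.
have /existsP[j /andP[Aj Fj]] : [exists j, A j && F j]; last by exists j.
apply: contraT => /existsPn none; move: sT; rewrite big1 // => j Aj.
by move: (none j); rewrite Aj => /negbTE.
Qed.

Lemma sum_offdiag_swap S (F : 'I_n -> 'I_n -> bool) :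
  \sum_(i in S) \sum_(j in S :\ i) F i j =
  \sum_(i in S) \sum_(j in S :\ i) F j i.
Proof.
rewrite (exchange_big_dep (mem S)) /=; last by move=> i j _ /setD1P[].
apply: eq_bigr => j jS; apply: eq_bigl => i.
by rewrite !inE jS andbT eq_sym andbC.
Qed.

(** The terms of index (i, j) and (j, i) cancel mod 2. *)
Lemma sum_offdiag_sym S (F : 'I_n -> 'I_n -> bool) :
  (forall i j, i != j -> F i j = F j i) ->
  \sum_(i in S) \sum_(j in S :\ i) F i j = 0.
Proof.
move=> Fsym.
have -> : \sum_(i in S) \sum_(j in S :\ i) F i j =
   \sum_(i in S) \sum_(j in S :\ i | (i < j)%N) F i j +
   \sum_(i in S) \sum_(j in S :\ i | (j < i)%N) F i j.
  rewrite -big_split; apply: eq_bigr => i _ /=.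
  rewrite (bigID (fun j : 'I_n => (i < j)%N)) /=; congr (_ + _).
  apply: eq_bigl => j; rewrite !inE -leqNgt [in RHS]ltn_neqAle.
  by case: (eqVneq j i) => //= /negbTE; rewrite -val_eqE => ->.
rewrite [X in _ + X](exchange_big_dep (mem S)) /=; last first.
  by move=> i j _ /andP[/setD1P[]].
rewrite [X in _ + X](_ : _ = \sum_(i in S) \sum_(j in S :\ i | (i < j)%N) F i j).
  exact: addbool.
apply: eq_bigr => j jS; apply: eq_big => i.
  by rewrite !inE jS andbT eq_sym andbCA andbA.
by move=> /andP[iS /andP[/setD1P[ji _] _]]; apply: Fsym; rewrite eq_sym.
Qed.

(** Coboundaries are cocycles and so are their cup products: the two sides are
    the contributions of the upper and of the lower faces of the cube.  After
    expanding one factor, everything cancels either by the induction hypothesis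
    or because the two orders of travelling along two edges agree. *)
Lemma cup_closed fs S x :
  \sum_(i in S) cup fs (S :\ i) (step x i) = \sum_(i in S) cup fs (S :\ i) x.
Proof.
elim: fs S x => [//|f fs IH] S x /=.
have rmC i j : S :\ i :\ j = S :\ j :\ i.
  by apply/setP => k; rewrite !inE andbCA.
transitivity (\sum_(i in S) \sum_(j in S :\ i)
    f (step x i) * cup fs (S :\ i :\ j) (step x i)).
  rewrite -[RHS]add0r.
  (* the terms containing f at the second step are symmetric in i and j *)
  rewrite -[X in _ = X + _](@sum_offdiag_sym S (fun i j => f (step (step x i) j) *
     cup fs (S :\ i :\ j) (step (step x i) j))); last first.
    by move=> i j ij; rewrite (stepC _ ij) rmC.
  rewrite -big_split; apply: eq_bigr => i _ /=.
  rewrite -[X in _ = _ + X]mulr_sumr -IH mulr_sumr -big_split.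
  by apply: eq_bigr => j _ /=; rewrite mulrDl.
transitivity (\sum_(i in S) \sum_(j in S :\ i)
    f (step x j) * cup fs (S :\ j :\ i) (step x j)).
  exact: sum_offdiag_swap.
apply/esym; transitivity (\sum_(i in S) \sum_(j in S :\ i)
  f (step x j) * cup fs (S :\ i :\ j) (step x j)).
  rewrite -[RHS]addr0.
  (* the terms containing f x become symmetric after using IH *)
  rewrite -[X in _ = _ + X](@sum_offdiag_sym S (fun i j => f x *
     cup fs (S :\ i :\ j) x)); last by move=> i j ij; rewrite rmC.
  rewrite -big_split; apply: eq_bigr => i _ /=.
  rewrite -[X in _ = _ + X]mulr_sumr -IH mulr_sumr -big_split.
  by apply: eq_bigr => j _ /=; rewrite mulrDl.
by apply: eq_bigr => i _; apply: eq_bigr => j _; rewrite rmC.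
Qed.

(** The closedness of [cup fs] turns the product with the coboundary of [f] into
    the coboundary of the product with [f]; this is what can be telescoped. *)
Lemma cup_cons f fs S x : cup (f :: fs) S x =
  \sum_(i in S) (f (step x i) * cup fs (S :\ i) (step x i) +
                 f x * cup fs (S :\ i) x).
Proof.
rewrite big_split /= -[X in _ = _ + X]mulr_sumr -cup_closed mulr_sumr -big_split.
by apply: eq_bigr => i _ /=; rewrite mulrDl.
Qed.

(** On a face orthogonal to direction [j], a labelling that is constant on the
    hyperplane of that face contributes a zero coboundary. *)
Lemma cup_const j b f fs S x : f \in fs -> j \notin S ->
  (forall y, y j = x j -> f y = b) -> cup fs S x = 0.
Proof.
elim: fs S x => [//|h fs IH] S x; rewrite inE => fin jS fb /=.
apply: big1 => i iS.
have ij : j != i by apply: contraNneq jS => ->.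
have xj : step x i j = x j by rewrite /step upd_neq.
case/predU1P: fin => [<-|fin].
  by rewrite !fb // addbool mul0r.
rewrite (IH (S :\ i) (step x i)) ?mulr0 //.
  by rewrite !inE negb_and jS orbT.
by move=> y; rewrite xj; apply: fb.
Qed.

(** A nonzero cup product exhibits a chain of edges of the cube along which each
    labelling in turn takes both values. *)
Lemma cup_neq0 fs S x : cup fs S x -> {in fs, forall f, exists y z,
  [/\ forall k, (x k <= y k <= x k + (k \in S))%N,
      forall k, (x k <= z k <= x k + (k \in S))%N & f y != f z]}.
Proof.
elim: fs S x => [//|h fs IH] S x cupT f fin.
have [i iS] := sum_bool_exists cupT.
rewrite -[is_true _]/(is_true (_ && _)) => /andP[hi cupi].
have stepb k : (x k <= step x i k <= x k + (k \in S))%N.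
  rewrite /step /upd; case: eqVneq => [->|_]; last by rewrite leqnn leq_addr.
  by rewrite iS addn1 leqnSn leqnn.
move: fin; rewrite inE => /predU1P[->|fin].
  exists (step x i), x; split=> //.
    by move=> k; rewrite leqnn leq_addr.
  by move: hi; case: (h _); case: (h _).
have [y [z [yb zb yz]]] := IH _ _ cupi f fin.
have low k m : (step x i k <= m <= step x i k + (k \in S :\ i))%N ->
    (x k <= m <= x k + (k \in S))%N.
  rewrite /step /upd !inE; case: eqVneq => //= ->.
  by rewrite iS addn0 addn1 => /andP[/ltnW -> ->].
by exists y, z; split=> // k; apply: low.
Qed.

Context (p : nat).

(** Summation over the box [0, p)^s: the coordinates listed in [s] run from 0 to
    p - 1 and the others keep their value in [x].  Iterated sums in the order of
    [s] make it easy to single out one direction. *)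
Fixpoint boxsum (s : seq 'I_n) (F : ('I_n -> nat) -> bool) x : bool :=
  if s is i :: s' then \sum_(c < p) boxsum s' F (upd x i c) else F x.

Lemma eq_boxsum s F G x :
  (forall y, (forall k, k \notin s -> y k = x k) -> F y = G y) ->
  boxsum s F x = boxsum s G x.
Proof.
elim: s x => [|i s IH] x FG /=; first exact: FG.
apply: eq_bigr => c _; apply: IH => y yE; apply: FG => k.
by rewrite inE negb_or => /andP[ki ks]; rewrite yE // upd_neq.
Qed.

Lemma boxsum0 s x : boxsum s (fun=> 0) x = 0.
Proof. by elim: s x => //= i s IH x; rewrite big1. Qed.

Lemma boxsum_sum s (J : finType) (P : pred J) F x :
  boxsum s (fun y => \sum_(j | P j) F j y) x = \sum_(j | P j) boxsum s (F j) x.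
Proof.
elim: s x => //= i s IH x; rewrite exchange_big /=.
by apply: eq_bigr => c _.
Qed.

Lemma boxsumD s F G x : boxsum s (fun y => F y + G y) x =
  boxsum s F x + boxsum s G x.
Proof.
elim: s x => //= i s IH x; rewrite -big_split /=.
by apply: eq_bigr => c _.
Qed.

Lemma boxsum_step s j F x : j \notin s ->
  boxsum s (fun y => F (step y j)) x = boxsum s F (step x j).
Proof.
elim: s x => //= i s IH x; rewrite inE negb_or => /andP[ji js].
apply: eq_bigr => c _; rewrite IH //; congr (boxsum s F _).
by rewrite /step upd_neq // updC // eq_sym.
Qed.

Lemma boxsum_rem s j F x : j \in s -> uniq s ->
  boxsum s F x = boxsum (j :: rem j s) F x.
Proof.
elim: s x => //= i s IH x; rewrite inE.
case: (eqVneq i j) => [-> //|ij /= js /andP[_ us]].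
under eq_bigr do rewrite IH //=.
rewrite exchange_big /=; apply: eq_bigr => c _; apply: eq_bigr => d _.
by rewrite updC.
Qed.

Lemma boxsum_telescope s j F x : j \in s -> uniq s ->
  boxsum s (fun y => F (step y j) + F y) x =
  boxsum (rem j s) F (upd x j p) + boxsum (rem j s) F (upd x j 0%N).
Proof.
move=> js us; rewrite (boxsum_rem _ _ js us) /=.
pose a c := boxsum (rem j s) F (upd x j c).
transitivity (\sum_(0 <= c < p) (a c.+1 - a c)); last first.
  by rewrite telescope_sumr.
rewrite big_mkord; apply: eq_bigr => c _; rewrite boxsumD; congr (_ + _).
rewrite boxsum_step ?mem_rem_uniqF //.
by rewrite /step upd_eq upd_upd.
Qed.

(** Write the integrand as a sum of differences in the directions [j] of [s] and
    telescope.  For [j] other than the head [i], the two boundary terms vanish by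
    [cup_const], since [l j] is constant there.  For [j = i] the lower boundary
    term vanishes and on the upper one [l i] is 1, which leaves the same sum in
    one dimension less. *)
Lemma boxsum_cup (l : 'I_n -> ('I_n -> nat) -> bool) (s : seq 'I_n) x :
  uniq s ->
  {in s, forall i y, y i = 0%N -> l i y = false} ->
  {in s, forall i y, y i = p -> l i y = true} ->
  boxsum s (cup (map l s) [set i in s]) x = true.
Proof.
elim: s x => [//|i s IH] x /[dup] us /= /andP[is' us'] l0 l1.
set S := [set _ in _].
pose H j y := l i y * cup (map l s) (S :\ j) y.
transitivity (boxsum (i :: s)
    (fun y => \sum_(j in S) (H j (step y j) + H j y)) x).
  by apply: (@eq_boxsum (i :: s)) => y _; exact: cup_cons.
have SiE : S :\ i = [set j in s].
  apply/setP => j; rewrite !inE; case: eqVneq => //= ->.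
  by rewrite (negbTE is').
have Hi : boxsum (i :: s) (fun y => H i (step y i) + H i y) x = true.
  rewrite boxsum_telescope ?mem_head //= eqxx.
  rewrite [X in _ + X](_ : _ = 0) ?addr0; last first.
    rewrite -[RHS](boxsum0 s (upd x i 0%N)); apply: eq_boxsum => y yE.
    by rewrite /H l0 ?mul0r ?mem_head // yE // upd_eq.
  rewrite -[RHS](IH (upd x i p)) //.
  - apply: eq_boxsum => y yE; rewrite /H SiE l1 ?mul1r ?mem_head //.
    by rewrite yE // upd_eq.
  - by move=> j js; apply: l0; rewrite inE js orbT.
  - by move=> j js; apply: l1; rewrite inE js orbT.
have Hj j : j \in s ->
    boxsum (i :: s) (fun y => H j (step y j) + H j y) x = 0.
  move=> js; have jis : j \in i :: s by rewrite inE js orbT.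
  have face c b : (forall y, y j = c -> l j y = b) ->
      boxsum (rem j (i :: s)) (H j) (upd x j c) = 0.
    move=> lb; rewrite -[RHS](boxsum0 (rem j (i :: s)) (upd x j c)).
    apply: eq_boxsum => y yE; rewrite /H (@cup_const j b (l j)) ?mulr0 //.
    - exact: map_f.
    - by rewrite !inE eqxx.
    - move=> z zj; apply: lb; rewrite zj yE ?upd_eq //.
      by rewrite mem_rem_uniqF.
  rewrite boxsum_telescope //.
  by rewrite (face p true) ?(face 0%N false) //; [exact: l0|exact: l1].
rewrite boxsum_sum (bigD1 i); last by rewrite !inE eqxx.
rewrite Hi big1 // => j /andP[jS ji]; apply: Hj.
by move: jS; rewrite !inE (negbTE ji).
Qed.

Lemma boxsum_exists s F x : boxsum s F x ->
  exists2 y, F y & forall k, if k \in s then (y k < p)%N else y k == x k.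
Proof.
elim: s x => [|i s IH] x /=; first by exists x.
move=> /sum_bool_exists[c _ /IH[y Fy yb]].
exists y => // k; move: (yb k); rewrite inE /upd.
case: (k \in s); rewrite ?orbT ?orbF //.
by case: (k =P i) => [->|_ /eqP ->] // /eqP ->.
Qed.

(** A discrete Poincare-Miranda theorem, known as Kuhn's lemma.  By [boxsum_cup]
    the cup products over the unit cubes of the grid add up to 1, so one of them
    is nonzero and [cup_neq0] applies to it. *)
Theorem kuhn_cube (l : 'I_n -> ('I_n -> nat) -> bool) :
  (forall i y, y i = 0%N -> l i y = false) ->
  (forall i y, y i = p -> l i y = true) ->
  exists2 x : 'I_n -> nat, forall k, (x k < p)%N &
  forall i, exists y z,
    [/\ forall k, (x k <= y k <= (x k).+1)%N,
        forall k, (x k <= z k <= (x k).+1)%N, l i y = false & l i z = true].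
Proof.
move=> l0 l1.
have /boxsum_exists[x cupx xb] := boxsum_cup (fun=> 0%N) (enum_uniq 'I_n)
  (fun i _ => l0 i) (fun i _ => l1 i).
exists x => [k|i]; first by move: (xb k); rewrite mem_enum.
have /(_ (l i)) [|y [z [yb zb yz]]] := cup_neq0 cupx.
  by apply: map_f; rewrite mem_enum.
have {}yb k : (x k <= y k <= (x k).+1)%N.
  by move: (yb k); rewrite inE mem_enum inE addn1.
have {}zb k : (x k <= z k <= (x k).+1)%N.
  by move: (zb k); rewrite inE mem_enum inE addn1.
by case ly: (l i y) yz; case lz: (l i z) => // _; [exists z, y|exists y, z].
Qed.
End CubicalCup.

Local Open Scope classical_set_scope.

(** * A fixed point theorem in R^n *)

Lemma mx_norm_lt (R : realType) n (v : 'rV[R]_n) (e : R) : 0 < e ->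
  (forall i, `|v ord0 i| < e) -> `|v| < e.
Proof.
move=> e0 ve; have : ball (0 : 'rV[R]_n) e v.
  by split=> // i j; rewrite ord1 /ball /= mxE sub0r normrN.
by rewrite -ball_normE /ball_ /= sub0r normrN.
Qed.

Lemma coord_le_norm (R : realType) n (v : 'rV[R]_n) i : `|v ord0 i| <= `|v|.
Proof.
rewrite [leRHS]/Num.norm /= mx_normrE.
by apply/bigmax_geP; right => /=; exists (ord0, i).
Qed.

(** Label a grid point [v] of the cube of radius B + 1 by the signs of the
    coordinates of v - G v; the extra 1 makes the sign determined on the faces.
    Cubes given by [kuhn_cube] on finer and finer grids accumulate at a point
    where, by continuity, no coordinate of v - G v can be nonzero. *)
Theorem brouwer_bounded (R : realType) n (G : 'rV[R]_n -> 'rV[R]_n) (B : R) :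
  continuous G -> (forall v i, `|G v ord0 i| <= B) -> exists v, G v = v.
Proof.
move=> Gc GB.
have [B0|B0] := ltP B 0.
  (* a negative bound forces n = 0 *)
  exists 0; apply/rowP => i; suff : B < B by rewrite ltxx.
  by apply: lt_le_trans (GB 0 i); rewrite (lt_le_trans B0).
pose b := B + 1; have b0 : 0 < b by rewrite /b; lra.
have approx k : exists v : 'rV[R]_n, (forall i, `[- b, b]%classic (v ord0 i)) /\
    forall i, exists r s : 'rV[R]_n,
      [/\ forall j, `|v ord0 j - r ord0 j| <= (2 * b) / k.+1%:R,
          forall j, `|v ord0 j - s ord0 j| <= (2 * b) / k.+1%:R,
          r ord0 i - G r ord0 i < 0 & 0 <= s ord0 i - G s ord0 i].
  have k0 : 0 < k.+1%:R :> R by rewrite ltr0n.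
  have c0 : 0 < 2 * b / k.+1%:R by rewrite divr_gt0 // mulr_gt0.
  pose pt (y : 'I_n -> nat) : 'rV[R]_n :=
    \row_i (- b + 2 * b / k.+1%:R * (y i)%:R).
  have [i y yi|i y yi|x xk xl] := @kuhn_cube n k.+1
    (fun i y => 0 <= pt y ord0 i - G (pt y) ord0 i).
  - apply/negbTE; rewrite -ltNge mxE yi mulr0 addr0.
    by have := GB (pt y) i; rewrite ler_norml /b => /andP[]; lra.
  - rewrite mxE yi; apply/idP; rewrite divfK ?lt0r_neq0 //.
    by have := GB (pt y) i; rewrite ler_norml /b => /andP[]; lra.
  have close y j : (forall j, (x j <= y j <= (x j).+1)%N) ->
      `|pt x ord0 j - pt y ord0 j| <= 2 * b / k.+1%:R.
    move=> /(_ j) /andP[xy yx]; rewrite !mxE.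
    rewrite (_ : _ - _ = - (2 * b / k.+1%:R * ((y j)%:R - (x j)%:R)));
      last by ring.
    rewrite normrN normrM (gtr0_norm c0) ler_piMr ?(ltW c0) //.
    by rewrite -natrB // normr_nat lern1 leq_subLR addn1.
  exists (pt x); split=> [i|i].
    rewrite /= in_itv /= mxE lerDl; apply/andP; split.
      by rewrite mulr_ge0 // ltW.
    have : 2 * b / k.+1%:R * (x i)%:R <= 2 * b.
      rewrite mulrAC ler_pdivrMr // ler_wpM2l ?mulr_ge0 ?(ltW b0) //.
      by rewrite ler_nat ltnW.
    by move: (2 * b / _ * _) => t; lra.
  have [y [z [yx zx ly lz]]] := xl i; exists (pt y), (pt z); split=> //.
  - by move=> j; apply: close.
  - by move=> j; apply: close.
  - by rewrite ltNge ly.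
have [v vP] := choice approx.
have cpt : compact [set w : 'rV[R]_n | forall i, `[- b, b]%classic (w ord0 i)].
  apply: (@rV_compact _ _ (fun=> `[- b, b]%classic)) => _.
  exact: segment_compact.
have vcube : (v @ \oo)
    [set w : 'rV[R]_n | forall i, `[- b, b]%classic (w ord0 i)].
  by exists 0%N => // k _; apply: (vP k).1.
have [w [_ clw]] := cpt (v @ \oo) _ vcube.
exists w; apply/esym/rowP => i; apply/eqP; rewrite -subr_eq0; apply/eqP.
pose H (u : 'rV[R]_n) := u ord0 i - G u ord0 i.
have Hc : {for w, continuous H}.
  apply: (@continuousB _ _ _ (fun u : 'rV[R]_n => u ord0 i)
                             (fun u : 'rV[R]_n => G u ord0 i)).
    exact: coord_continuous.
  apply: (@continuous_comp _ _ _ G (fun u : 'rV[R]_n => u ord0 i)).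
    exact: Gc.
  exact: coord_continuous.
apply/eqP/negPn/negP => Hw; have {}Hw : 0 < `|H w| by rewrite normr_gt0.
have /nbhs_ballP[e /= e0 eH] : \forall u \near w, `|H w - H u| < `|H w|.
  by move/cvgrPdist_lt: Hc; apply.
have Ne : \forall k \near \oo, 2 * b / k.+1%:R < e / 2.
  have d0 : 0 < e / 2 / (2 * b) by rewrite !divr_gt0 // mulr_gt0.
  have := near_infty_natSinv_lt (PosNum d0); apply: filterS => k /=.
  by rewrite ltr_pdivlMr ?mulr_gt0 // mulrC.
have [_ [[k ke <-] wk]] : [set v k | k in [set k | 2 * b / k.+1%:R < e / 2]]
    `&` ball w (e / 2) !=set0.
  apply: clw; last by apply: nbhsx_ballx; rewrite divr_gt0.
  by apply: filterS Ne => k ke; exists k.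
have [_ /(_ i) [r [s [vr vs Hr Hs]]]] := vP k.
have inball (u : 'rV[R]_n) :
    (forall j, `|v k ord0 j - u ord0 j| <= 2 * b / k.+1%:R) ->
    `|H w - H u| < `|H w|.
  move=> vu; apply: eH; apply: (le_ball (_ : e / 2 + e / 2 <= e)); first by lra.
  apply: ball_triangle wk _; split=> [|a j]; first by rewrite divr_gt0.
  by rewrite ord1 /ball /=; apply: le_lt_trans (vu j) ke.
have := inball _ vr; have := inball _ vs.
rewrite -/(H r) in Hr; rewrite -/(H s) in Hs.
have [Hw0|Hw0] := ltP (H w) 0.
  by rewrite (ltr0_norm Hw0) => /ltr_normlP[]; lra.
by rewrite (ger0_norm Hw0) => _ /ltr_normlP[]; lra.
Qed.

(** * Closed subspaces of finite codimension *)

Section Codim.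
Context {R : realType} {X : normedModType R}.
Implicit Types (V : set X) (d x y z : X) (a b : R).

Lemma subspace0 V : linear_subspace V -> V 0.
Proof. by case=> /set_mem. Qed.

Lemma subspaceP V a x y : linear_subspace V -> V x -> V y -> V (a *: x + y).
Proof. by case=> _ VL Vx Vy; apply/set_mem/VL; exact/mem_set. Qed.

Lemma subspaceZ V a x : linear_subspace V -> V x -> V (a *: x).
Proof.
by move=> VL Vx; rewrite -[_ *: _]addr0; apply: subspaceP (subspace0 VL).
Qed.

Lemma subspaceD V x y : linear_subspace V -> V x -> V y -> V (x + y).
Proof. by move=> VL Vx Vy; rewrite -[x]scale1r; exact: subspaceP. Qed.

Lemma subspaceB V x y : linear_subspace V -> V x -> V y -> V (x - y).
Proof.
by move=> VL Vx Vy; rewrite -[- y]scaleN1r addrC; apply: subspaceP.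
Qed.

Definition add_line V d : set X := [set x | exists a, V (x - a *: d)].

Lemma add_line_subspace V d :
  linear_subspace V -> linear_subspace (add_line V d).
Proof.
move=> VL; split=> [|a x y /set_mem[b xb] /set_mem[c yc]].
  by apply/mem_set; exists 0; rewrite scale0r subr0; exact: subspace0.
apply/mem_set; exists (a * b + c).
rewrite scalerDl -scalerA opprD addrACA -scalerBr; exact: subspaceP.
Qed.

Lemma coeff_unique V d a b x : linear_subspace V -> ~ V d ->
  V (x - a *: d) -> V (x - b *: d) -> a = b.
Proof.
move=> VL Vd xa xb; apply: contrapT => ab; apply: Vd.
have ab0 : a - b != 0 by rewrite subr_eq0; apply/eqP.
rewrite -[d](scalerK ab0); apply: subspaceZ => //.
have -> : (a - b) *: d = (x - b *: d) - (x - a *: d); last exact: subspaceB.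
by rewrite scalerBl opprB [RHS]addrC subrKA.
Qed.

(** If the ball of radius e about [d] misses [V], then a point x of V + a d
    satisfies |x| >= |a| e, because d - x / a lies in [V]. *)
Lemma coeff_bounded V d : linear_subspace V -> closed V -> ~ V d ->
  exists2 c, 0 < c & forall a x, V (x - a *: d) -> `|a| <= c * `|x|.
Proof.
move=> VL Vc Vd.
have /nbhs_ballP[e /= e0 eV] : nbhs d (~` V).
  by apply: open_nbhs_nbhs; split => //; exact: closed_openC.
exists e^-1; first by rewrite invr_gt0.
move=> a x xa; have [->|a0] := eqVneq a 0.
  by rewrite normr0 mulr_ge0 // invr_ge0 ltW.
rewrite mulrC ler_pdivlMr // mulrC -ler_pdivlMr ?normr_gt0 // leNgt.
apply/negP => xe; apply: (eV (d - a^-1 *: x)).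
  rewrite -ball_normE /ball_ /= opprB addrC subrK.
  by rewrite normrZ normfV mulrC.
rewrite (_ : _ - _ = (- a^-1) *: (x - a *: d)); first exact: subspaceZ.
by rewrite scalerBr !scaleNr opprK scalerK // addrC.
Qed.

(** For points of V + R d that converge to z, the coefficients of d stay bounded
    by [coeff_bounded]; if a is one of their cluster points, then z - a d is
    adherent to [V]. *)
Lemma add_line_closed V d : linear_subspace V -> closed V -> ~ V d ->
  closed (add_line V d).
Proof.
move=> VL Vc Vd z clz; have [c c0 cV] := coeff_bounded VL Vc Vd.
have approx k : exists ax : R * X,
    `|z - ax.2| < k.+1%:R^-1 /\ V (ax.2 - ax.1 *: d).
  have [|x [[a xa]]] := clz (ball z k.+1%:R^-1).
    by apply: nbhsx_ballx; rewrite invr_gt0.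
  by rewrite -ball_normE => zx; exists (a, x).
have [u uP] := choice approx.
pose B := c * (`|z| + 1).
have uB : ((fst \o u) @ \oo) `[- B, B]%classic.
  exists 0%N => // k _; rewrite /= in_itv /= -ler_norml.
  have [zk /cV /le_trans] := uP k; apply; rewrite ler_wpM2l ?(ltW c0) //.
  rewrite -[(u k).2](subrK z) addrC (le_trans (ler_normD _ _)) // lerD2l.
  by rewrite distrC (le_trans (ltW zk)) // invf_le1 // ler1n.
have [a [_ cla]] := @segment_compact R (- B) B ((fst \o u) @ \oo) _ uB.
exists a; apply: Vc => U /nbhs_ballP[e /= e0 eU].
pose r := e / 2 / (`|d| + 1).
have d0 : 0 < `|d| + 1 by rewrite ltr_wpDl.
have r0 : 0 < r by rewrite !divr_gt0.
have e20 : 0 < e / 2 by rewrite divr_gt0.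
have [_ [[k ke <-] ak]] : [set (u k).1 | k in [set k | k.+1%:R^-1 < e / 2]]
    `&` ball a r !=set0.
  apply: cla; last exact: nbhsx_ballx.
  apply: filterS (near_infty_natSinv_lt (PosNum e20)) => k ke.
  by exists k.
exists ((u k).2 - (u k).1 *: d); have [zk Vk] := uP k; split=> //.
apply: eU; rewrite -ball_normE /ball_ /=.
rewrite [X in `|X|](_ : _ = (z - (u k).2) - (a - (u k).1) *: d); last first.
  by rewrite scalerBl !opprD !opprK addrACA.
rewrite (le_lt_trans (ler_normB _ _)) // [e]splitr.
rewrite ltr_leD //; first exact: lt_trans ke.
rewrite normrZ (le_trans (_ : _ <= r * `|d|)) //.
  by rewrite ler_wpM2r // ltW // -[_ < _]/(ball_ Num.norm a r _) ball_normE.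
by rewrite /r mulrAC ler_pdivrMr // ler_wpM2l ?(ltW e20) // lerDl.
Qed.

(** Induction on the number of vectors that span X modulo [V].  If the first
    vector [d] is not in [V], the induction hypothesis for V + R d provides
    coordinates that reduce x to a point of V + R d, and the coefficient of [d]
    in this point is the missing coordinate, bounded by [coeff_bounded]. *)
Theorem closed_finite_codim_coords V :
  linear_subspace V -> closed V -> finite_codimensional V ->
  exists n (p : 'I_n -> X -> R) (e : 'I_n -> X) (c : R),
  [/\ forall i a x y, p i (a *: x + y) = a * p i x + p i y,
      forall i x, `|p i x| <= c * `|x|,
      forall i x, V x -> p i x = 0 &
      forall x, V (x - \sum_(i < n) p i x *: e i)].
Proof.
move=> VL Vc [n [e]]; elim: n V VL Vc e => [|n IH] V VL Vc e spanV.
  exists 0%N, (fun _ _ => 0), (fun=> 0), 0; split=> [[]|[]|[]|x] //.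
  by have [a] := spanV x; rewrite !big_ord0.
set d := e ord0.
have [Vd|Vd] := pselect (V d).
  apply: (IH V VL Vc (fun i => e (lift ord0 i))) => z.
  have [a] := spanV z; rewrite big_ord_recl => Vz.
  exists (fun i => a (lift ord0 i)).
  have := subspaceD VL Vz (subspaceZ (a ord0) VL Vd).
  by rewrite opprD addrA addrAC subrK.
have [|||m [p [f [c [pL pB pV pf]]]]] :=
  IH (add_line V d) _ _ (fun i => e (lift ord0 i)).
- exact: add_line_subspace.
- exact: add_line_closed.
- move=> z; have [a Vz] := spanV z; exists (fun i => a (lift ord0 i)), (a ord0).
  by move: Vz; rewrite big_ord_recl opprD addrA addrAC.
have [q qP] := choice pf.
have [c1 c10 c1P] := coeff_bounded VL Vc Vd.
exists m.+1, (fun i => if unlift ord0 i is Some j then p j else q),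
  (fun i => if unlift ord0 i is Some j then f j else d),
  (`|c| + c1 * (1 + `|c| * \sum_(j < m) `|f j|)).
have s0 : 0 <= \sum_(j < m) `|f j| by exact: sumr_ge0.
split.
- move=> i a x y; case: unliftP => [j _|_] //.
  apply: (@coeff_unique V d _ _
    (a *: x + y - \sum_(j < m) p j (a *: x + y) *: f j)) => //.
  have := subspaceP a VL (qP x) (qP y); congr V.
  have -> : \sum_(j < m) p j (a *: x + y) *: f j =
      a *: (\sum_(j < m) p j x *: f j) + \sum_(j < m) p j y *: f j.
    rewrite scaler_sumr -big_split; apply: eq_bigr => j _ /=.
    by rewrite pL scalerDl scalerA.
  rewrite !scalerBr scalerDl scalerA !opprD addrACA; congr (_ + _).
  by rewrite addrACA.
- move=> i x; case: unliftP => [j _|_].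
    apply: le_trans (pB j x) _; rewrite ler_wpM2r //.
    rewrite (le_trans (ler_norm _)) // lerDl mulr_ge0 ?(ltW c10) //.
    by rewrite addr_ge0 // mulr_ge0.
  apply: le_trans (c1P _ _ (qP x)) _.
  rewrite mulrDl ler_wpDl ?mulr_ge0 // -mulrA ler_wpM2l ?(ltW c10) //.
  rewrite mulrDl mul1r (le_trans (ler_normB _ _)) // lerD2l.
  rewrite (le_trans (ler_norm_sum _ _ _)) // mulrAC mulr_sumr ler_sum // => j _.
  rewrite normrZ ler_wpM2r // (le_trans (pB j x)) // ler_wpM2r //.
  exact: ler_norm.
- move=> i x Vx.
  have V1x : add_line V d x by exists 0; rewrite scale0r subr0.
  case: unliftP => [j _|_]; first exact: pV.
  apply: (@coeff_unique V d _ _ x) => //; last by rewrite scale0r subr0.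
  have := qP x; rewrite big1 ?subr0 // => j _.
  by rewrite pV // scale0r.
- move=> x; rewrite big_ord_recl unlift_none.
  under eq_bigr do rewrite liftK.
  by have := qP x; rewrite opprD addrA addrAC.
Qed.

End Codim.
Lemma bounded_linear_map_continuous (R : realType) (V W : normedModType R)
    (T : {linear V -> W}) (c : R) :
  (forall x, `|T x| <= c * `|x|) -> continuous T.
Proof.
move=> Tc; apply: bounded_linear_continuous; apply/linear_boundedP.
exists c; split; first exact: num_real.
by move=> r cr x; rewrite (le_trans (Tc x)) // ler_wpM2r // ltW.
Qed.

Lemma closed_finite_codim_quotient (R : realType) (X : normedModType R)
    (V : set X) :
  linear_subspace V -> closed V -> finite_codimensional V ->
  exists n (P : {linear X -> 'rV[R]_n}) (L : {linear 'rV[R]_n -> X}) (a b : R),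
  [/\ forall x, `|P x| <= a * `|x|, forall v, `|L v| <= b * `|v|,
      forall x, V x -> P x = 0 & forall x, V (x - L (P x))].
Proof.
move=> VL Vc /(closed_finite_codim_coords VL Vc)[n [p [e [c [pL pB pV pe]]]]].
pose P x := \row_(j < n) p j x.
have PL : linear P by move=> a x y; apply/rowP => j; rewrite !mxE pL.
pose L (v : 'rV[R]_n) := \sum_(j < n) v ord0 j *: e j.
have LL : linear L.
  move=> a u v; rewrite scaler_sumr -big_split; apply: eq_bigr => j _ /=.
  by rewrite !mxE scalerDl scalerA.
pose P' := HB.pack_for {linear X -> 'rV[R]_n} P
  (GRing.isLinear.Build _ _ _ _ P PL).
pose L' := HB.pack_for {linear 'rV[R]_n -> X} L
  (GRing.isLinear.Build _ _ _ _ L LL).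
exists n, P', L', (`|c|), (\sum_(j < n) `|e j|); split=> [x|v|x Vx|x].
- rewrite [leLHS]/Num.norm /= mx_normrE; apply/bigmax_leP; split=> [|[i j] _ /=].
    by rewrite mulr_ge0.
  rewrite mxE (le_trans (pB j x)) // ler_wpM2r //; exact: ler_norm.
- rewrite (le_trans (ler_norm_sum _ _ _)) // mulr_suml ler_sum // => j _.
  by rewrite normrZ mulrC ler_wpM2l // coord_le_norm.
- by apply/rowP => j; rewrite !mxE pV.
- have := pe x; congr (V (_ - _)).
  by apply: eq_bigr => j _; rewrite mxE.
Qed.

(** * Continuous bounded lifts of the quotient map *)

Lemma continuous_maxr (R : realType) (T : topologicalType) (f g : T -> R) :
  continuous f -> continuous g -> continuous (fun x => Num.max (f x) (g x)).
Proof.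
by move=> fc gc x; have := @continuous_max R T f g x (fc x) (gc x); exact.
Qed.


(** Cut the cube of radius [B] into cells of width [d] and choose a point of [A]
    over each cell that is reached. *)
Lemma finite_net (R : realType) (T : Type) n (A : set T) (q : T -> 'rV[R]_n)
    (B d : R) : A !=set0 -> (forall x, A x -> `|q x| <= B) -> 0 < d ->
  exists (K : finType) (t : K -> T),
    (forall k, A (t k)) /\ forall x, A x -> exists k, `|q x - q (t k)| < d.
Proof.
move=> [x0 Ax0] qB d0.
pose m := Num.truncn (2 * B / d).
pose cell x : {ffun 'I_n -> 'I_m.+1} :=
  [ffun j => inord (Num.truncn ((q x ord0 j + B) / d))].
have rep k : exists x, A x /\ forall y, A y -> cell y = k -> cell x = k.
  have [[y [Ay yk]]|none] := pselect (exists y, A y /\ cell y = k).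
    by exists y.
  by exists x0; split=> // y Ay yk; case: none; exists y.
have [t tP] := choice rep.
exists {ffun 'I_n -> 'I_m.+1}, t; split=> [k|x Ax]; first by case: (tP k).
have [At /(_ x Ax erefl) tx] := tP (cell x); exists (cell x).
set y := t _ in At tx *.
apply: mx_norm_lt => // j; rewrite !mxE.
have pos z : A z -> 0 <= (q z ord0 j + B) / d.
  move=> Az; rewrite divr_ge0 ?(ltW d0) //.
  have := le_trans (coord_le_norm (q z) j) (qB z Az).
  by rewrite ler_norml => /andP[]; lra.
have small z : A z -> (Num.truncn ((q z ord0 j + B) / d) < m.+1)%N.
  move=> Az; rewrite ltnS /m le_truncn // ler_pM2r ?invr_gt0 //.
  have := le_trans (coord_le_norm (q z) j) (qB z Az).
  by rewrite ler_norml => /andP[]; lra.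
have trunc_eq : Num.truncn ((q x ord0 j + B) / d) =
    Num.truncn ((q y ord0 j + B) / d).
  move/ffunP: tx => /(_ j); rewrite !ffunE => /(congr1 val).
  by rewrite /= !inordK ?small.
have /andP[xl xr] := truncn_itv (pos x Ax).
have /andP[yl yr] := truncn_itv (pos y At).
rewrite trunc_eq in xl xr.
move: xl xr yl yr; rewrite ler_pdivlMr // ler_pdivlMr // !ltr_pdivrMr // -natr1.
set N := _%:R; rewrite mulrDl mul1r ltr_norml => *; apply/andP; split; lra.
Qed.

(** Take points t_k of the ball of radius [r] whose images form a d-net of the
    image of that ball, with d small.  A partition of unity by tent functions
    centred at the P t_k averages the t_k into a point q v of norm at most [r]
    with P (q v) within 2d of v, for v in the image of the ball.  The error is
    then removed exactly by the linear map [L]; truncating it at norm 2d keeps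
    the correction below s - r for every v, and changes nothing on the image of
    the ball. *)
Lemma continuous_lift (R : realType) (X : normedModType R) n
    (P : {linear X -> 'rV[R]_n}) (L : {linear 'rV[R]_n -> X}) (a b r s : R) :
  (forall x, `|P x| <= a * `|x|) -> (forall v, `|L v| <= b * `|v|) ->
  (forall x, P (x - L (P x)) = 0) -> 0 <= r -> r < s ->
  exists S : 'rV[R]_n -> X, [/\ continuous S, forall v, `|S v| <= s &
    forall x, `|x| <= r -> P (S (P x)) = P x].
Proof.
move=> Pa Lb PLP r0 rs.
pose b1 := `|b| + 1; have b0 : 0 < b1 by rewrite ltr_wpDl.
pose d := (s - r) / b1 / 2.
have d0 : 0 < d by rewrite !divr_gt0 // subr_gt0.
have ne : [set x : X | `|x| <= r] !=set0 by exists 0; rewrite /= normr0.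
have [x|K [t [tr net]]] := @finite_net R X n _ P (`|a| * r) d ne _ d0.
  move=> /= xr; rewrite (le_trans (Pa x)) //.
  by rewrite (le_trans (ler_wpM2r _ (ler_norm a))) // ler_wpM2l.
pose w k (v : 'rV[R]_n) : R := Num.max 0 (2 * d - `|v - P (t k)|).
(* on P (ball r) the sum of the tents is at least d; the maximum with d keeps
   the denominator away from 0 elsewhere *)
pose D v := Num.max d (\sum_k w k v).
pose q v : X := (D v)^-1 *: \sum_k w k v *: t k.
pose clamp (u : 'rV[R]_n) := (2 * d / Num.max (2 * d) `|u|) *: u.
have w0 k v : 0 <= w k v by rewrite le_max lexx.
have D0 v : 0 < D v by rewrite lt_max d0.
have M0 (u : 'rV[R]_n) : 0 < Num.max (2 * d) `|u| by rewrite lt_max mulr_gt0.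
have wc k : continuous (w k).
  refine (@continuous_maxr R 'rV[R]_n (fun=> 0)
    (fun v => 2 * d - `|v - P (t k)|) _ _).
    exact: cst_continuous.
  move=> v; apply: (@continuousB R R^o 'rV[R]_n (fun=> 2 * d)
    (fun v => `|v - P (t k)|)); first exact: cst_continuous.
  apply: (@continuous_comp 'rV[R]_n _ _ (fun v => v - P (t k)) Num.norm);
    last exact: norm_continuous.
  by apply: continuousB; [exact: cvg_id|exact: cst_continuous].
have Dc : continuous D.
  refine (@continuous_maxr R 'rV[R]_n (fun=> d) (fun v => \sum_k w k v) _ _).
    exact: cst_continuous.
  by apply: continuous_big => [|k _]; [exact: add_continuous|exact: wc].
have qc : continuous q.
  move=> v.
  apply: (@continuousZ R X 'rV[R]_n (fun v => (D v)^-1)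
    (fun v => \sum_k w k v *: t k)).
    by apply: continuousV; [exact: lt0r_neq0|exact: Dc].
  apply: continuous_big => [|k _ u]; first exact: add_continuous.
  by apply: continuousZ; [exact: wc|exact: cst_continuous].
have Pc := bounded_linear_map_continuous Pa.
have Lc := bounded_linear_map_continuous Lb.
have clampc : continuous clamp.
  move=> u; apply: (@continuousZ R 'rV[R]_n 'rV[R]_n
    (fun u => 2 * d / Num.max (2 * d) `|u|) id); last exact: cvg_id.
  apply: (@continuousM R 'rV[R]_n (fun=> 2 * d)
    (fun u => (Num.max (2 * d) `|u|)^-1)); first exact: cst_continuous.
  apply: continuousV; first exact: lt0r_neq0.
  refine (@continuous_maxr R 'rV[R]_n (fun=> 2 * d) Num.norm _ _ _).
    exact: cst_continuous.
  exact: norm_continuous.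
have qr v : `|q v| <= r.
  rewrite normrZ normfV (gtr0_norm (D0 v)) mulrC ler_pdivrMr //.
  rewrite (le_trans (ler_norm_sum _ _ _)) //.
  rewrite (le_trans (_ : _ <= \sum_k r * w k v)) //.
    apply: ler_sum => k _; rewrite normrZ ger0_norm // mulrC ler_wpM2r //.
    exact: tr.
  by rewrite -mulr_sumr ler_wpM2l // le_max lexx orbT.
have clampd u : `|clamp u| <= 2 * d.
  have dd0 : 0 < 2 * d by rewrite mulr_gt0.
  rewrite normrZ ger0_norm ?divr_ge0 ?(ltW dd0) ?(ltW (M0 u)) //.
  rewrite mulrAC ler_pdivrMr // ler_wpM2l ?(ltW dd0) //.
  by rewrite le_max lexx orbT.
exists (fun v => q v + L (clamp (v - P (q v)))); split.
- move=> v; apply: (@continuousD R X 'rV[R]_n q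
    (fun v => L (clamp (v - P (q v))))); first exact: qc.
  apply: (@continuous_comp 'rV[R]_n _ _ (fun v => clamp (v - P (q v))) L);
    last exact: Lc.
  apply: (@continuous_comp 'rV[R]_n _ _ (fun v => v - P (q v)) clamp);
    last exact: clampc.
  apply: continuousB; first exact: cvg_id.
  by apply: continuous_comp; [exact: qc|exact: Pc].
- move=> v; rewrite (le_trans (ler_normD _ _)) //.
  rewrite -[s](subrKC r) lerD ?qr // (le_trans (Lb _)) //.
  rewrite (le_trans (_ : _ <= b1 * (2 * d))) //.
    rewrite (le_trans (ler_wpM2r _ (_ : b <= b1))) //.
      by rewrite (le_trans (ler_norm b)) // lerDl.
    by rewrite ler_wpM2l ?(ltW b0) ?clampd.
  by rewrite /d (mulrC 2) divfK // mulrC divfK // lt0r_neq0.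
- move=> x xr; set v := P x.
  have [k0 k0d] := net x xr.
  have Dw : D v = \sum_k w k v.
    apply/max_idPr; rewrite (bigD1 k0) //=.
    rewrite (le_trans (_ : _ <= w k0 v)) ?lerDl ?sumr_ge0 //.
    by rewrite le_max; apply/orP; right; move: k0d; rewrite -/v; lra.
  have close : `|v - P (q v)| <= 2 * d.
    have -> : v - P (q v) = (D v)^-1 *: \sum_k w k v *: (v - P (t k)).
      under eq_bigr do rewrite scalerBr.
      rewrite sumrB -scaler_suml -Dw scalerBr scalerK ?lt0r_neq0 //.
      rewrite /q linearZ /= linear_sum /=.
      by under [in RHS]eq_bigr do rewrite -linearZ.
    rewrite normrZ normfV (gtr0_norm (D0 v)) mulrC ler_pdivrMr //.
    rewrite (le_trans (ler_norm_sum _ _ _)) // Dw mulr_sumr ler_sum // => k _.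
    rewrite normrZ (ger0_norm (w0 k v)) mulrC.
    have [wk0|] := eqVneq (w k v) 0; first by rewrite wk0 !mulr0.
    move=> wk0; rewrite ler_wpM2r //.
    case: (ltP 0 (2 * d - `|v - P (t k)|)) wk0 => [|le0]; last first.
      by rewrite /w (max_l le0) eqxx.
    by move=> + _; lra.
  have -> : clamp (v - P (q v)) = v - P (q v).
    rewrite /clamp max_l // divff ?scale1r //.
    by rewrite lt0r_neq0 // mulr_gt0.
  have vE : v - P (q v) = P (x - q v) by rewrite linearB.
  have /subr0_eq lift : P (x - q v) - P (L (P (x - q v))) = 0.
    by rewrite -linearB PLP.
  by rewrite linearD /= vE -lift linearB addrC subrK.
Qed.

(** * The Gorelik principle *)

(** The fixed point argument is made for v |-> P (S v - phi (S v)), where P is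
    the quotient map modulo [V] and S the lift of [continuous_lift].  The set [A]
    does not depend on phi because all these maps take values in the same
    cube. *)
Theorem gorelik_principle (R : realType) (X : normedModType R) (V : set X)
    (r s : R) : linear_subspace V -> closed V -> finite_codimensional V ->
  0 <= r -> r < s ->
  exists A : set X, [/\ compact A, forall a, A a -> `|a| <= s &
    forall phi : X -> X, continuous phi -> (forall x, `|x - phi x| <= r) ->
    exists2 a, A a & V (phi a)].
Proof.
move=> VL Vc Vf r0 rs.
have [n [P [L [a [b [Pa Lb PV VP]]]]]] := closed_finite_codim_quotient VL Vc Vf.
have PLP x : P (x - L (P x)) = 0 by exact: PV.
have [S [Sc Ss SP]] := continuous_lift Pa Lb PLP r0 rs.
have Pc := bounded_linear_map_continuous Pa.
pose Q : set 'rV[R]_n :=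
  [set v | forall i, `[- (`|a| * r), `|a| * r]%classic (v ord0 i)].
exists (S @` Q); split=> [|_ [v _ <-] //|phi phic phir].
  apply: continuous_compact; first exact: continuous_subspaceT.
  apply: (@rV_compact _ _ (fun=> `[- (`|a| * r), `|a| * r]%classic)) => _.
  exact: segment_compact.
pose G v := P (S v - phi (S v)).
have GB v i : `|G v ord0 i| <= `|a| * r.
  rewrite (le_trans (coord_le_norm _ _)) // (le_trans (Pa _)) //.
  by rewrite (le_trans (ler_wpM2r _ (ler_norm a))) // ler_wpM2l.
have Gc : continuous G.
  move=> v; apply: (@continuous_comp _ _ _ (fun v => S v - phi (S v)) P);
    last exact: Pc.
  apply: (@continuousB R X 'rV[R]_n S (phi \o S)); first exact: Sc.
  by apply: continuous_comp; [exact: Sc|exact: phic].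
have [v Gv] := brouwer_bounded Gc GB.
exists (S v).
  by exists v => // i; rewrite /= in_itv /= -ler_norml -Gv.
suff Pphi : P (phi (S v)) = 0 by have := VP (phi (S v));
  rewrite Pphi linear0 subr0.
have PSv : P (S v) = v by rewrite -{1}Gv SP.
have : v - P (phi (S v)) = v by rewrite -[RHS]Gv /G linearB /= PSv.
by move/eqP; rewrite subr_eq addrC -subr_eq subrr => /eqP.
Qed.

Theorem theorem5p3 (R : realType) (X Y : completeNormedModType R)
  (f : X -> Y) (g : Y -> X) (C D M : R)
  (f_continuous : continuous f) (g_continuous : continuous g)
  (C_gt0 : 0 < C) (D_gt0 : 0 < D) (M_gt0 : 0 < M)
  (g_lipschitz : forall y y' : Y, `|g y - g y'| <= D + M * `|y - y'|)
  (gf_near_id : forall x : X, `|(g \o f) x - x| <= C)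
  (fg_near_id : forall y : Y, `|(f \o g) y - y| <= C)
  (lambda : R) (lambda_gt0 : 0 < lambda) (lambda_lt1 : lambda < 1) :
  forall alpha : R, 2 * (C + D) * (1 - lambda)^-1 <= alpha ->
  forall X0 : set X,
    linear_subspace X0 -> closed X0 -> finite_codimensional X0 ->
  exists K : set Y, compact K /\
    scale_set (lambda * alpha / M) (unit_ball Y)
    `<=` add_set (add_set K (scale_set C (unit_ball Y)))
                 (f @` scale_set (2 * alpha) (X0 `&` unit_ball X)).
Proof.
move=> alpha; rewrite ler_pdivrMr ?subr_gt0 // => alpha_ge X0 X0L X0c X0f.
have alpha_gt0 : 0 < alpha.
  have : 0 < alpha * (1 - lambda) by apply: lt_le_trans alpha_ge; lra.
  by rewrite pmulr_lgt0 // subr_gt0.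
pose r := C + D + lambda * alpha.
have la0 : 0 < lambda * alpha by rewrite mulr_gt0.
have r0 : 0 <= r by rewrite /r; lra.
have r_lt : r < alpha by rewrite /r; lra.
have [A [Ac As Aphi]] := gorelik_principle X0L X0c X0f r0 r_lt.
exists ((fun x => - f x) @` A); split.
  apply: continuous_compact => //; apply: continuous_subspaceT => x.
  by apply: continuousN; exact: f_continuous.
move=> _ [u u1 <-]; set y := _ *: u.
have My : M * `|y| <= lambda * alpha.
  rewrite normrZ ger0_norm ?divr_ge0 ?(ltW la0) ?(ltW M_gt0) //.
  rewrite mulrA (mulrC M) divfK ?lt0r_neq0 // ler_piMr ?(ltW la0) //.
  by move: u1; rewrite /unit_ball /closed_ball_ /= sub0r normrN.
pose phi x := g (y + f x).
have phic : continuous phi.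
  move=> x; apply: (@continuous_comp _ _ _ (fun x => y + f x) g);
    last exact: g_continuous.
  by apply: continuousD; [exact: cst_continuous|exact: f_continuous].
have phir x : `|x - phi x| <= r.
  rewrite -(subrKA (g (f x))) (le_trans (ler_normD _ _)) // /r -addrA lerD //.
    by rewrite distrC; exact: gf_near_id.
  rewrite (le_trans (g_lipschitz _ _)) // lerD2l.
  by rewrite opprD addrCA subrr addr0 normrN.
have [a Aa X0x] := Aphi phi phic phir; set x := phi a in X0x.
have xa : `|x| <= 2 * alpha.
  rewrite -[x](subrKC a) (le_trans (ler_normD _ _)) //.
  by have := As a Aa; have := phir a; rewrite distrC -/x; lra.
have a20 : 0 < 2 * alpha by rewrite mulr_gt0.
have scaled (Z : normedModType R) (c : R) (z : Z) : 0 < c -> `|z| <= c ->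
    unit_ball Z (c^-1 *: z).
  move=> c0 zc; rewrite /unit_ball /closed_ball_ /= sub0r normrN normrZ.
  by rewrite normfV (gtr0_norm c0) mulrC ler_pdivrMr // mul1r.
exists (- f a + (y + f a - f x)).
  exists (- f a); first by exists a.
  exists (y + f a - f x) => //; exists (C^-1 *: (y + f a - f x)).
    by apply: scaled => //; rewrite distrC; exact: fg_near_id.
  by rewrite scalerA divff ?scale1r // lt0r_neq0.
exists (f x); last by rewrite addrA subrK addrC addrK.
exists x => //; exists ((2 * alpha)^-1 *: x); first split.
- exact: subspaceZ.
- exact: scaled.
- by rewrite scalerA divff ?scale1r // lt0r_neq0.
Qed.
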